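(* Let $m_1,m_2\in\mathbb{N}$, $m=\operatorname{lcm}(m_1,m_2)$ and $a_1,a_2\in\mathbb{Z}$, and put $R_{(a_1,a_2)}(m_1,m_2)=\sum_{1\le k\le m,\ \gcd(k,m)=1}c_{m_1}(k-a_1)c_{m_2}(k-a_2)$. Then $$R_{(a_1,a_2)}(m_1,m_2)=\phi(m)\sum_{\substack{d_1\mid m_1,\ d_2\mid m_2\\ \gcd(d_1,a_1)=1,\ \gcd(d_2,a_2)=1\\ \gcd(d_1,d_2)\mid a_1-a_2}}\frac{d_1\mu(m_1/d_1)\,d_2\mu(m_2/d_2)}{\phi(\operatorname{lcm}(d_1,d_2))}.$$ Furthermore, if $\gcd(a_1,m_1)=\gcd(a_2,m_2)=1$ and $|a_1-a_2|=1$, then $$R_{(a_1,a_2)}(m_1,m_2)=\begin{cases}(-1)^{\omega(\gcd(m_1,m_2))}\psi(\gcd(m_1,m_2)), & \text{if } m_1 \text{ and } m_2 \text{ are squarefree},\\ 0,&\text{otherwise}.\end{cases}$$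
   Context: For $n\in\mathbb{N}$ and $k\in\mathbb{Z}$, $c_n(k)=\sum_{1\le j\le n,\ \gcd(j,n)=1}\exp(2\pi i jk/n)$ is the Ramanujan sum. $\mu$ is the Möbius function, $\phi$ Euler's totient, $\omega(n)$ the number of distinct prime factors of $n$, and $\psi(n)=n\prod_{p\mid n}(1+1/p)$ the Dedekind function. *)

(* Defs.v *)
From mathcomp Require Import all_boot all_order all_algebra.
From mathcomp Require Import reals.
From mathcomp.analysis Require Import sequences exp trigo.
From mathcomp Require Import complex.

Set Implicit Arguments.
Unset Strict Implicit.
Unset Printing Implicit Defensive.

Import GRing.Theory Num.Theory.

Local Open Scope ring_scope.
Local Open Scope complex_scope.

Definition squarefree (n : nat) : bool :=
  (0 < n)%N && all (fun p => ~~ (p ^ 2 %| n)%N) (primes n).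

Definition omega (n : nat) : nat := size (primes n).

Definition mobius (n : nat) : int :=
  if squarefree n then (-1) ^+ omega n else 0.

Definition dedekind_psi (F : numFieldType) (n : nat) : F :=
  n%:R * \prod_(p <- primes n) (1 + p%:R^-1).

Definition cexp (R : realType) (z : R[i]) : R[i] :=
  (expR (complex.Re z))%:C * (cos (complex.Im z) +i* sin (complex.Im z)).

Definition ramanujan_sum (R : realType) (n : nat) (k : int) : R[i] :=
  \sum_(1 <= j < n.+1 | coprime j n)
     cexp (2%:R * (@pi R)%:C * 'i%C * j%:R * k%:~R / n%:R).

Definition ramanujan_corr (R : realType) (a1 a2 : int) (m1 m2 : nat) : R[i] :=
  let m := lcmn m1 m2 in
  \sum_(1 <= k < m.+1 | coprime k m)
     ramanujan_sum R m1 (k%:Z - a1) * ramanujan_sum R m2 (k%:Z - a2).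

(* Main.v *)
(** Expanding the coprimality condition with the Möbius function and summing
    geometric progressions of roots of unity gives
    [c_n(k) = \sum_(d | n, d | k) d mu(n/d)].  Substituting this in the
    correlation, the coefficient of the pair [(d1, d2)] is the number of units [k]
    modulo [m] with [k = a1 %[mod d1]] and [k = a2 %[mod d2]]; as the units modulo
    [m] are equidistributed among the unit classes modulo [lcm d1 d2], it is
    [phi m / phi (lcm d1 d2)] when the congruences are compatible with units and
    [0] otherwise.

    In the second part only coprime pairs remain.  If [f] is multiplicative with
    [f (p ^ k.+1) = f (p ^ k)] for [k > 0], then [\sum_(d | m) f d mu(m/d)] is
    [\prod_(p | m) (f p - 1)] for squarefree [m] and [0] otherwise.  This is applied
    to the inner sum over [d1], with [f d = d / phi d] restricted to the [d] coprime
    to [d2], and then to the sum over [d2]. *)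
Require Import Defs.
From mathcomp Require Import all_boot all_order all_algebra.
From mathcomp Require Import reals.
From mathcomp.analysis Require Import sequences exp trigo.
From mathcomp Require Import complex.
From mathcomp Require Import zify ring lra.

Set Implicit Arguments.
Unset Strict Implicit.
Unset Printing Implicit Defensive.

Import GRing.Theory Num.Theory.

Local Open Scope ring_scope.
Local Open Scope complex_scope.

(** * Divisors and the Möbius function on coprime products *)

Lemma perm_divisors_complement (n : nat) : (0 < n)%N ->
  perm_eq [seq (n %/ d)%N | d <- divisors n] (divisors n).
Proof.
move=> n0; have dvE d : (d \in divisors n) = (d %| n)%N by rewrite dvdn_divisors.
have divK d : (d %| n)%N -> (n %/ (n %/ d) = d)%N by move=> dn; rewrite divnA // mulKn.
have inj : {in divisors n &, injective (fun d => n %/ d)%N}.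
  by move=> d e; rewrite !dvE => /divK {2}<- /divK {2}<- /= ->.
apply: uniq_perm; rewrite ?map_inj_in_uniq ?divisors_uniq // => d.
apply/mapP/idP => [[e]|]; rewrite dvE.
  by move=> en ->; rewrite dvE; apply/dvdnP; exists e; rewrite mulnC divnK.
move=> dn; exists (n %/ d)%N; last by rewrite divK.
by rewrite dvE; apply/dvdnP; exists d; rewrite mulnC divnK.
Qed.

Lemma perm_divisors_coprime_mul (a b : nat) :
  (0 < a)%N -> (0 < b)%N -> coprime a b ->
  perm_eq [seq (d * e)%N | d <- divisors a, e <- divisors b] (divisors (a * b)).
Proof.
move=> a0 b0 cab; have ab0 : (0 < a * b)%N by rewrite muln_gt0 a0.
apply: uniq_perm; rewrite ?divisors_uniq //.
  apply: allpairs_uniq; rewrite ?divisors_uniq // => -[d e] [d' e'].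
  case/allpairsP=> -[x y] /= []; rewrite -!dvdn_divisors // => xa yb [-> ->].
  case/allpairsP=> -[x' y'] /= []; rewrite -!dvdn_divisors // => xa' yb' [-> ->] E.
  (* The first factor is recovered from the product as its gcd with [a]; this gives injectivity. *)
  have G u v : (u %| a)%N -> (v %| b)%N -> gcdn (u * v) a = u.
    move=> ua vb; have cva : coprime v a by rewrite coprime_sym (coprime_dvdr vb).
    by rewrite gcdnC Gauss_gcdl; [apply/gcdn_idPr | rewrite coprime_sym].
  have ex : x = x' by rewrite -(G x y) // E G.
  by move: E; rewrite -ex => /eqP; rewrite eqn_pmul2l ?(dvdn_gt0 a0) // => /eqP ->.
move=> d; rewrite -dvdn_divisors //; apply/allpairsP/idP.
  case=> -[x y] /=; rewrite -!dvdn_divisors // => -[xa yb ->].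
  exact: dvdn_mul.
move=> dab; exists (gcdn d a, gcdn d b) => /=; rewrite -!dvdn_divisors // !dvdn_gcdr.
split=> //; apply/eqP; rewrite eqn_dvd; apply/andP; split; last first.
  by rewrite Gauss_dvd ?dvdn_gcdl //; apply: coprime_dvdl (dvdn_gcdr _ _) _;
     apply: coprime_dvdr (dvdn_gcdr _ _) _.
by rewrite muln_gcdr !muln_gcdl !dvdn_gcd dab dvdn_mulr //= dvdn_mull // dvdn_mulr.
Qed.

Lemma squarefreeM (a b : nat) : (0 < a)%N -> (0 < b)%N -> coprime a b ->
  squarefree (a * b) = squarefree a && squarefree b.
Proof.
move=> a0 b0 cab; rewrite /squarefree muln_gt0 a0 b0 /=.
apply/allP/andP => [H|[/allP Ha /allP Hb] p].
  split; apply/allP => p pp; (have := H p; rewrite primesM // pp ?orbT => /(_ isT));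
    apply: contra => h; [exact: dvdn_mulr | exact: dvdn_mull].
rewrite primesM //; case: (boolP (p \in primes a)) => pa /=.
  move=> _; have := Ha p pa; rewrite Gauss_dvdl //.
  apply: coprimeXl; apply: coprime_dvdl cab.
  by move: pa; rewrite mem_primes => /and3P[].
move=> pb; rewrite Gauss_dvdr ?Hb //; apply: coprimeXl; move: pa pb.
rewrite !mem_primes a0 b0 /= => + /andP[pp _].
by rewrite pp /= prime_coprime.
Qed.

Lemma perm_primesM (a b : nat) : (0 < a)%N -> (0 < b)%N -> coprime a b ->
  perm_eq (primes (a * b)) (primes a ++ primes b).
Proof.
move=> a0 b0 cab; apply: uniq_perm; rewrite ?primes_uniq //.
  by rewrite cat_uniq !primes_uniq /= andbT -coprime_has_primes // coprime_sym.
by move=> p; rewrite primesM // mem_cat.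
Qed.

Lemma mobiusM (a b : nat) : (0 < a)%N -> (0 < b)%N -> coprime a b ->
  mobius (a * b) = mobius a * mobius b.
Proof.
move=> a0 b0 cab; rewrite /mobius squarefreeM // /omega.
rewrite (perm_size (perm_primesM a0 b0 cab)) size_cat exprD.
by case: ifP => [/andP[-> ->]//|]; case: squarefree => /= [->|_]; rewrite ?mulr0 ?mul0r.
Qed.

Lemma squarefree_pfactor (p k : nat) : prime p -> squarefree (p ^ k) = (k <= 1)%N.
Proof.
move=> pp; rewrite /squarefree expn_gt0 prime_gt0 //=; case: k => [|k] //=.
by rewrite primesX // primes_prime //= andbT (dvdn_Pexp2l _ _ (prime_gt1 pp)); case: k.
Qed.

Lemma mobius1 : mobius 1 = 1.
Proof. by []. Qed.

Lemma mobius_prime (p : nat) : prime p -> mobius p = -1.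
Proof.
by move=> pp; rewrite /mobius -{1}(expn1 p) squarefree_pfactor // /omega primes_prime.
Qed.

Lemma mobius_pfactor (p k : nat) : prime p -> (1 < k)%N -> mobius (p ^ k) = 0.
Proof. by move=> pp k1; rewrite /mobius squarefree_pfactor // leqNgt k1. Qed.

Lemma perm_divisors_pfactor (p k : nat) : prime p ->
  perm_eq [seq (p ^ i)%N | i <- iota 0 k.+1] (divisors (p ^ k)).
Proof.
move=> pp; have pk0 : (0 < p ^ k)%N by rewrite expn_gt0 prime_gt0.
apply: uniq_perm; rewrite ?divisors_uniq //.
  by rewrite map_inj_uniq ?iota_uniq //; apply: expnI; apply: prime_gt1.
move=> d; rewrite -dvdn_divisors //.
apply/mapP/(dvdn_pfactor _ _ pp) => [[ i ]|[i ik ->]]; last by exists i; rewrite ?mem_iota.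
by rewrite mem_iota => /andP[_ ik] ->; exists i.
Qed.

(** * Möbius-weighted divisor sums of multiplicative functions *)

Section MobiusSum.
Variables (F : comNzRingType) (f : nat -> F).
Hypothesis f1 : f 1%N = 1.
Hypothesis fM : forall a b, (0 < a)%N -> (0 < b)%N -> coprime a b ->
  f (a * b)%N = f a * f b.

(** Each divisor of [a * b] is uniquely a product [d * e], and both [f] and [mobius] split along it;
    this is the multiplicativity of the Dirichlet convolution of [f] with [mobius]. *)
Lemma mobius_sumM (a b : nat) : (0 < a)%N -> (0 < b)%N -> coprime a b ->
  \sum_(d <- divisors (a * b)) f d * (mobius (a * b %/ d))%:~R =
  (\sum_(d <- divisors a) f d * (mobius (a %/ d))%:~R) *
  (\sum_(d <- divisors b) f d * (mobius (b %/ d))%:~R).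
Proof.
move=> a0 b0 cab; rewrite -(perm_big _ (perm_divisors_coprime_mul a0 b0 cab)) /=.
rewrite big_allpairs_dep mulr_suml; apply: eq_big_seq => d.
rewrite -dvdn_divisors // => da; rewrite mulr_sumr; apply: eq_big_seq => e.
rewrite -dvdn_divisors // => eb.
have d0 := dvdn_gt0 a0 da; have e0 := dvdn_gt0 b0 eb.
have -> : (a * b %/ (d * e) = (a %/ d) * (b %/ e))%N.
  by rewrite -{1}(divnK da) -{1}(divnK eb) mulnACA mulnK // muln_gt0 d0.
rewrite fM //; last by apply: coprime_dvdl da _; apply: coprime_dvdr eb _.
have ad0 : (0 < a %/ d)%N by rewrite divn_gt0 // dvdn_leq.
have be0 : (0 < b %/ e)%N by rewrite divn_gt0 // dvdn_leq.
have cde : coprime (a %/ d) (b %/ e).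
  by apply: coprime_dvdl (dvdn_div da) _; apply: coprime_dvdr (dvdn_div eb) _.
rewrite (mobiusM ad0 be0 cde).
rewrite intrM.
by rewrite mulrACA.
Qed.

(** Together with [f1] and [fM] this makes [f n], for [n > 0], depend only on the set of primes
    dividing [n]. *)
Hypothesis fX : forall p k, prime p -> (0 < k)%N -> f (p ^ k.+1)%N = f (p ^ k)%N.

(** As [mobius] vanishes on [p ^ i] for [i > 1], only the two largest divisors contribute, giving
    [f (p ^ k) - f (p ^ k.-1)]; by [fX] this is zero unless [k = 1]. *)
Lemma mobius_sum_pfactor (p k : nat) : prime p -> (0 < k)%N ->
  \sum_(d <- divisors (p ^ k)) f d * (mobius (p ^ k %/ d))%:~R =
  if k == 1%N then f p - 1 else 0.
Proof.
move=> pp; rewrite -(perm_big _ (perm_divisors_pfactor k pp)) big_map.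
case: k => [//|k] _; have p0 := prime_gt0 pp.
rewrite -addn2 iotaD big_cat /= !add0n !big_cons big_nil addr0.
rewrite big_seq big1 ?add0r; last first.
  move=> i; rewrite mem_iota /= add0n => ik.
  rewrite -expnB //; last by lia.
  by rewrite mobius_pfactor ?mulr0 //; lia.
rewrite -!expnB // subSnn subnn mobius1 expn1 mobius_prime //.
case: k => [|k]; first by rewrite f1 expn1; ring.
by rewrite (fX (k := k.+1)) //=; ring.
Qed.

(** Strong induction on [m], splitting off the full power of its smallest prime factor. *)
Lemma mobius_sum (m : nat) : (0 < m)%N ->
  \sum_(d <- divisors m) f d * (mobius (m %/ d))%:~R =
  if squarefree m then \prod_(p <- primes m) (f p - 1) else 0.
Proof.
have [n] := ubnP m; elim: n m => // n IH m; rewrite ltnS => mn m0.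
have [m1|m1] := leqP m 1.
  have -> : m = 1%N by lia.
  by rewrite /= big_cons big_nil f1 addr0 mulr1 big_nil.
have pp := pdiv_prime m1; set p := pdiv m in pp *.
have k0 : (0 < logn p m)%N by rewrite logn_gt0 mem_primes pp m0 pdiv_dvd.
have [m' cpm' mE] := pfactor_coprime pp m0; move: k0 mE; set k := logn p m => k0 mE.
have m'0 : (0 < m')%N by case: m' mE {cpm'} => //; lia.
have pk0 : (0 < p ^ k)%N by rewrite expn_gt0 prime_gt0.
have c : coprime (p ^ k) m' by rewrite coprime_pexpl.
have pk1 : (1 < p ^ k)%N.
  by rewrite -(expn0 p) ltn_exp2l // prime_gt1.
rewrite mE mulnC mobius_sumM // squarefreeM // mobius_sum_pfactor // IH //; last first.
  by rewrite (leq_trans _ mn) // mE ltn_Pmulr.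
rewrite (perm_big _ (perm_primesM pk0 m'0 c)) big_cat /= squarefree_pfactor //.
rewrite primesX // (primes_prime pp) big_seq1 -(prednK k0).
by case: k.-1 => [|j] /=; case: ifP => _; rewrite ?expn1 ?mul0r ?mulr0.
Qed.

End MobiusSum.

(** The case of constant [f = 1] in [mobius_sum]: every factor [f p - 1] is zero, so only the empty
    product at [n = 1] survives. *)
Lemma mobius_sum_delta (F : comNzRingType) (n : nat) : (0 < n)%N ->
  \sum_(d <- divisors n) (mobius d)%:~R = (n == 1%N)%:R :> F.
Proof.
move=> n0; rewrite -(perm_big _ (perm_divisors_complement n0)) big_map.
transitivity (\sum_(d <- divisors n) 1 * (mobius (n %/ d))%:~R : F).
  by apply: eq_bigr => d _; rewrite mul1r.
rewrite (@mobius_sum _ (fun=> 1)) // => [|a b _ _ _]; last by rewrite mulr1.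
case: (n =P 1%N) => [->|n1]; first by rewrite big_nil.
case: ifP => // _; have n1' : (1 < n)%N by lia.
have : pdiv n \in primes n by rewrite mem_primes pdiv_prime // n0 pdiv_dvd.
case: (primes n) => [//|p s] _; by rewrite big_cons subrr mul0r.
Qed.

(** * Units modulo [m] in prescribed residue classes *)

(* [t] collects the primes of [m] dividing neither [c] nor [l], so that every
   prime of [m] divides exactly one of the coprime summands of [c + l * t]. *)
Lemma coprime_lift (l m c : nat) : (0 < m)%N -> (l %| m)%N -> coprime c l ->
  exists2 u, coprime u m & u = c %[mod l].
Proof.
move=> m0 lm ccl; have l0 := dvdn_gt0 m0 lm.
(* For [c = 0] coprimality forces [l = 1], and any unit will do. The case is split off because
   [\pi(0)] is empty, so that [t] below would be [m] itself. *)
have [c0|c0] := posnP c.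
  exists 1%N; rewrite ?coprime1n //.
  by move: ccl; rewrite c0 /coprime gcd0n => /eqP ->; rewrite !modn1.
set t := (m`_(\pi(c * l))^')%N.
exists (c + l * t)%N; last by rewrite addnC mulnC modnMDl.
rewrite coprime_has_primes ?addn_gt0 ?c0 //.
apply/hasPn => p; rewrite !mem_primes addn_gt0 c0 m0 /= => /andP[pp pm].
rewrite pp /=; apply/negP => pd.
have cl0 : (0 < c * l)%N by rewrite muln_gt0 c0.
have ptE : (p %| t)%N = ~~ (p %| c * l)%N.
  have := primes_part (\pi(c * l))^' m => /(congr1 (fun s => p \in s)).
  rewrite mem_filter !mem_primes m0 pp pm part_gt0 /= andbT => ->.
  by rewrite inE /= mem_primes pp cl0.
have [pc|pc] := boolP (p %| c)%N.
  move: pd; rewrite dvdn_addr // Euclid_dvdM // ptE dvdn_mulr //= orbF => pl.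
  have : (p %| 1)%N by rewrite -(eqP ccl) dvdn_gcd pc.
  by rewrite dvdn1 => /eqP p1; move: pp; rewrite p1.
have : (p %| l * t)%N.
  rewrite Euclid_dvdM // ptE Euclid_dvdM // (negbTE pc) /=; by case: (p %| l)%N.
by move=> plt; move: pd; rewrite dvdn_addl // (negbTE pc).
Qed.

Definition coprime_class_count (m l c : nat) : nat :=
  \sum_(k < m | coprime k m) (k == c %[mod l])%N.

Lemma coprime_class_countM (m l u c : nat) :
  (0 < m)%N -> (l %| m)%N -> coprime u m ->
  coprime_class_count m l (u * c) = coprime_class_count m l c.
Proof.
move=> m0 lm cum; rewrite /coprime_class_count.
have cul : coprime u l := coprime_dvdr lm cum.
pose h (k : 'I_m) := Ordinal (ltn_pmod (u * k) m0).
have eq_mulm d a b : coprime u d -> (u * a == u * b %[mod d]) = (a == b %[mod d]).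
  move=> cud; wlog ab : a b / (a <= b)%N => [W|].
    by case/orP: (leq_total a b) => /W // E; rewrite eq_sym E eq_sym.
  rewrite eq_sym [RHS]eq_sym !eqn_mod_dvd ?leq_mul // -mulnBr Gauss_dvdr //.
  by rewrite coprime_sym.
have hI : injective h.
  move=> i j /(congr1 val) /= /eqP; rewrite eq_mulm // !modn_small //.
  by move=> /eqP /val_inj.
rewrite (reindex_inj hI) /=; apply: eq_big => k /=.
  by rewrite coprime_modl coprimeMl cum.
by move=> _; rewrite modn_dvdm // eq_mulm.
Qed.

(* Multiplication by a lift of [c] to a unit modulo [m] permutes the units and
   carries the class of 1 to that of [c], so all unit classes have the same size. *)
Lemma coprime_class_count_totient (m l c : nat) :
  (0 < m)%N -> (l %| m)%N -> coprime c l ->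
  (coprime_class_count m l c * totient l = totient m)%N.
Proof.
move=> m0 lm ccl; have l0 := dvdn_gt0 m0 lm.
have N1 d : coprime d l -> coprime_class_count m l d = coprime_class_count m l 1.
  move=> cdl; have [u cum ud] := coprime_lift m0 lm cdl.
  rewrite -(coprime_class_countM 1 m0 lm cum) muln1.
  by apply: eq_bigr => k _; rewrite ud.
have totE n : totient n = \sum_(k < n | coprime k n) 1%N.
  rewrite totient_count_coprime big_mkord [RHS]big_mkcond /=.
  by apply: eq_bigr => i _; rewrite coprime_sym; case: coprime.
(* Double counting: the product becomes a sum of class sizes over all unit classes [d] modulo [l].
   After exchanging the sums, each unit [k] modulo [m] is counted exactly once, at [d = k %% l]. *)
rewrite N1 // (totE l) big_distrr /=.
under eq_bigr => d cdl do rewrite muln1 -(N1 d cdl).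
rewrite /coprime_class_count exchange_big /= (totE m); apply: eq_bigr => k ckm.
pose r := Ordinal (ltn_pmod k l0).
rewrite (bigD1 r) /=; last by rewrite coprime_modl (coprime_dvdr lm).
rewrite modn_mod eqxx big1 ?addn0 // => i /andP[_ ir].
by rewrite [(i %% l)%N]modn_small // eq_sym; move: ir; rewrite -val_eqE /= => /negbTE ->.
Qed.

(** Changes the representatives [1..n] of the residues into [0..n-1]; the hypotheses identify the
    term at [n] with the term at [0]. *)
Lemma sum_nat1_ord (V : nmodType) (n : nat) (P : pred nat) (F : nat -> V) :
  P 0%N = P n -> F 0%N = F n ->
  \sum_(1 <= k < n.+1 | P k) F k = \sum_(k < n | P k) F k.
Proof.
move=> P0 F0; rewrite -(big_mkord P F); case: n => [|n] in P0 F0 *.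
  by rewrite !big_geq.
rewrite big_mkcond [RHS]big_mkcond /= big_nat_recr //= [RHS]big_nat_recl //=.
by rewrite P0 F0 addrC; congr (_ + _); rewrite big_add1.
Qed.

Lemma sum_coprime_class (F : numFieldType) (m l : nat) (x : int) :
  (0 < m)%N -> (l %| m)%N -> coprimez x l%:Z ->
  \sum_(1 <= k < m.+1 | coprime k m) ((l%:Z %| k%:Z - x)%Z)%:R =
  (totient m)%:R / (totient l)%:R :> F.
Proof.
move=> m0 lm cxl; have l0 := dvdn_gt0 m0 lm.
have l0' : l%:Z != 0 by rewrite eqz_nat -lt0n.
(* The nonnegative representative of [x] turns the integer congruence into one between naturals,
   where the class count applies. *)
pose c := `|(x %% l%:Z)%Z|%N.
have cE : c%:Z = (x %% l%:Z)%Z by rewrite gez0_abs // modz_ge0.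
have dvE k : (l%:Z %| k%:Z - x)%Z = (k == c %[mod l])%N.
  rewrite -eqz_mod_dvd -eqz_nat -!modz_nat cE modz_mod.
  by [].
have ccl : coprime c l.
  have -> : coprime c l = coprimez c%:Z l%:Z by rewrite coprimezE.
  move: cxl; rewrite /coprimez cE; congr (_ == _); by rewrite gcdz_modl.
rewrite (@sum_nat1_ord F m (fun k => coprime k m)
    (fun k => ((l%:Z %| k%:Z - x)%Z)%:R)); first last.
- rewrite !dvE; congr (_%:R); congr nat_of_bool; congr (_ == _).
  by rewrite mod0n; apply/esym/eqP.
- by rewrite /coprime gcd0n gcdnn.
rewrite -(coprime_class_count_totient m0 lm ccl) natrM mulfK; last first.
  by rewrite pnatr_eq0 -lt0n totient_gt0.
by rewrite natr_sum; apply: eq_bigr => k _; rewrite dvE.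
Qed.

Lemma crt_int (d1 d2 : nat) (a1 a2 : int) : ((gcdn d1 d2)%:Z %| a1 - a2)%Z ->
  exists2 x : int, (d1%:Z %| x - a1)%Z & (d2%:Z %| x - a2)%Z.
Proof.
case/dvdzP => t tE; case: (Bezoutz d1%:Z d2%:Z) => u [v uv].
move: uv; rewrite /gcdz /= => uv.
(* Since [u * d1 + v * d2] is the gcd and [a1 - a2] is [t] times it, this number also equals
   [a2 + v * d2 * t]. *)
exists (a1 - u * d1%:Z * t).
  by apply/dvdzP; exists (- u * t); ring.
apply/dvdzP; exists (v * t).
have -> : a1 = a2 + t * (gcdn d1 d2)%:Z by rewrite -tE addrC subrK.
by rewrite -uv; ring.
Qed.

Lemma coprimez_congr (d : nat) (x a : int) : (d%:Z %| x - a)%Z ->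
  coprimez x d%:Z = coprimez d%:Z a.
Proof.
move=> h; rewrite coprimez_sym /coprimez -(subrK a x).
by case/dvdzP: h => q ->; rewrite gcdzMDl.
Qed.

Lemma coprimez_lcm (x : int) (d1 d2 : nat) :
  coprimez x d1%:Z -> coprimez x d2%:Z -> coprimez x (lcmn d1 d2)%:Z.
Proof.
move=> h1 h2; apply: (@coprimez_dvdr _ (d1 * d2)%N).
  by rewrite dvdn_lcm dvdn_mulr // dvdn_mull.
by rewrite PoszM coprimezMr h1.
Qed.

(** Compatible congruences amount to a single unit class modulo [lcmn d1 d2], to which
    [sum_coprime_class] applies. Conversely, a unit [k] lying in both classes forces all three
    conditions, so without them every term vanishes. *)
Lemma sum_coprime_two_classes (F : numFieldType) (m d1 d2 : nat) (a1 a2 : int) :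
  (0 < m)%N -> (d1 %| m)%N -> (d2 %| m)%N ->
  \sum_(1 <= k < m.+1 | coprime k m)
     ((d1%:Z %| k%:Z - a1)%Z && (d2%:Z %| k%:Z - a2)%Z)%:R =
  (if [&& coprimez d1%:Z a1, coprimez d2%:Z a2 & ((gcdn d1 d2)%:Z %| a1 - a2)%Z]
   then (totient m)%:R / (totient (lcmn d1 d2))%:R else 0) :> F.
Proof.
move=> m0 d1m d2m; case: ifP => [/and3P[c1 c2 /crt_int [x x1 x2]]|cond].
  have cx : coprimez x (lcmn d1 d2)%:Z.
    by apply: coprimez_lcm; rewrite (coprimez_congr x1, coprimez_congr x2).
  rewrite -(sum_coprime_class F m0 _ cx) ?dvdn_lcm ?d1m //.
  apply: eq_bigr => k _; rewrite dvdz_lcm; congr (_ && _)%:R.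
    by rewrite -[k%:Z - a1](subrKA x) rpredDr.
  by rewrite -[k%:Z - a2](subrKA x) rpredDr.
apply: big1 => k ckm; case: andP => // -[k1 k2]; move: cond.
rewrite -(coprimez_congr k1) -(coprimez_congr k2) !coprimezE !absz_nat.
rewrite (coprime_dvdr d1m ckm) (coprime_dvdr d2m ckm) /= => /negP[].
have -> : a1 - a2 = (k%:Z - a2) - (k%:Z - a1) by ring.
apply: rpredB; [apply: dvdz_trans k2 | apply: dvdz_trans k1].
  by rewrite dvdzE dvdn_gcdr.
by rewrite dvdzE dvdn_gcdl.
Qed.

(** * Roots of unity and the divisor formula for Ramanujan sums *)

Definition expi (R : realType) (x : R) : R[i] := cos x +i* sin x.

Lemma expiD (R : realType) (x y : R) : expi (x + y) = expi x * expi y.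
Proof. by rewrite /expi cosD sinD; simpc; congr (_ +i* _); rewrite addrC. Qed.

Lemma expi0 (R : realType) : expi (0 : R) = 1.
Proof. by rewrite /expi cos0 sin0. Qed.

Lemma expiMn (R : realType) (x : R) (n : nat) : expi (x *+ n) = expi x ^+ n.
Proof.
by elim: n => [|n IH]; rewrite ?expi0 // mulrS expiD IH exprS.
Qed.

Lemma expi_2piMz (R : realType) (q : int) : expi (2 * @pi R * q%:~R) = 1.
Proof.
have e1 : expi (2 * @pi R) = 1 by rewrite /expi mulr_natl cos2pi sin2pi.
case: q => n; first by rewrite -pmulrn mulr_natr expiMn e1 expr1n.
rewrite NegzE mulrNz mulrN; set x := _ * _.
have ex : expi x = 1 by rewrite /x -pmulrn mulr_natr expiMn e1 expr1n.
by rewrite -[LHS]mulr1 -[X in _ * X]ex -expiD addNr expi0.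
Qed.

(** Half-angle argument: [y = pi * r / n] lies strictly between [0] and [pi], so [sin y > 0],
    whereas [cos (2 * y) = 1] would force [sin y = 0]. *)
Lemma expi_root_neq1 (R : realType) (n r : nat) : (0 < r < n)%N ->
  expi (2 * @pi R * r%:R / n%:R) != 1.
Proof.
case/andP=> r0 rn; have n0 : (0 : R) < n%:R by rewrite ltr0n; lia.
set y := @pi R * r%:R / n%:R.
have y0 : 0 < sin y.
  apply: sin_gt0_pi; rewrite divr_gt0 ?mulr_gt0 ?pi_gt0 ?(ltr0n _ r) //=.
  by rewrite ltr_pdivrMr // ltr_pM2l ?pi_gt0 // ltr_nat.
apply/eqP => /(congr1 (@complex.Re R)) /=.
have -> : 2 * @pi R * r%:R / n%:R = y *+ 2 by rewrite /y mulr2n; ring.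
rewrite cos_mulr2n => E.
have : sin y ^+ 2 = 0 by have := cos2Dsin2 y; lra.
by move/eqP; rewrite sqrf_eq0 => /eqP s0; rewrite s0 Order.POrderTheory.ltxx in y0.
Qed.

Lemma sum_expi (R : realType) (n : nat) (k : int) : (0 < n)%N ->
  \sum_(1 <= j < n.+1) expi (2 * @pi R * k%:~R / n%:R *+ j) =
  n%:R * ((n%:Z %| k)%Z)%:R.
Proof.
move=> n0; have n0' : n%:R != 0 :> R by rewrite pnatr_eq0 -lt0n.
under eq_bigr => j _ do rewrite expiMn.
set z := expi _.
have zn : z ^+ n = 1.
  by rewrite /z -expiMn -[X in expi X]mulr_natr divfK // expi_2piMz.
rewrite (@sum_nat1_ord _ n xpredT (fun j => z ^+ j)) ?zn //.
have [/dvdzP [q kE]|ndk] := boolP (n%:Z %| k)%Z.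
  have -> : z = 1.
    by rewrite /z kE intrM -pmulrn -!mulrA mulfV // mulr1 mulrA expi_2piMz.
  by under eq_bigr do rewrite expr1n; rewrite sumr_const card_ord mulr1.
have z1 : z != 1.
  have nz : n%:Z != 0 by rewrite eqz_nat -lt0n.
  (* Reducing [k] modulo [n] changes the angle by a multiple of [2 * pi]; the residue [r] satisfies
     [0 < r < n] because [n] does not divide [k]. *)
  have rE := gez0_abs (modz_ge0 k nz).
  move: rE; set r := `|(k %% n%:Z)%Z|%N => rE.
  have -> : z = expi (2 * @pi R * r%:R / n%:R).
    have kE : k%:~R = (k %/ n%:Z)%Z%:~R * n%:R + r%:R :> R.
      by rewrite {1}(divz_eq k n%:Z) -rE intrD intrM.
    rewrite /z kE; set q := _%:~R.
    have -> : 2 * @pi R * (q * n%:R + r%:R) / n%:R = 2 * @pi R * q + 2 * @pi R * r%:R / n%:R.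
      by field.
    by rewrite expiD expi_2piMz mul1r.
  apply: expi_root_neq1; apply/andP; split.
    by rewrite lt0n -eqz_nat rE; apply: contra ndk => /eqP/dvdz_mod0P.
  by rewrite -ltz_nat rE ltz_pmod // ltz_nat.
rewrite mulr0; apply/eqP; have := subrX1 z n; rewrite zn subrr => /esym/eqP.
by rewrite mulf_eq0 subr_eq0 (negbTE z1).
Qed.

Lemma sum_multiples (V : nmodType) (d e : nat) (F : nat -> V) : (0 < d)%N ->
  \sum_(1 <= j < (d * e).+1 | (d %| j)%N) F j = \sum_(1 <= i < e.+1) F (d * i)%N.
Proof.
move=> d0; rewrite -big_filter -(big_map (muln d) xpredT F); apply: perm_big.
apply: uniq_perm; rewrite ?filter_uniq ?iota_uniq //.
  by rewrite map_inj_uniq ?iota_uniq // => i j /eqP; rewrite eqn_pmul2l // => /eqP.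
move=> j; rewrite mem_filter mem_index_iota ltnS.
apply/andP/mapP => [[/dvdnP[i ->]]|[ i ]].
  rewrite muln_gt0 mulnC leq_pmul2l // => /andP[/andP[i0 _] ie].
  by exists i; rewrite // mem_index_iota i0.
rewrite mem_index_iota => /andP[i0 ie] ->.
by rewrite dvdn_mulr // muln_gt0 d0 i0 leq_pmul2l.
Qed.

(** This is [mobius_sum_delta] at [gcdn j n], whose divisors are the divisors of [n] that divide
    [j]. *)
Lemma coprime_mobius (F : comNzRingType) (j n : nat) : (0 < n)%N ->
  (coprime j n)%:R = \sum_(d <- divisors n | (d %| j)%N) (mobius d)%:~R :> F.
Proof.
move=> n0; have g0 : (0 < gcdn j n)%N by rewrite gcdn_gt0 n0 orbT.
rewrite /coprime -mobius_sum_delta // -[RHS]big_filter; apply: perm_big.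
apply: uniq_perm; rewrite ?filter_uniq ?divisors_uniq // => d.
by rewrite mem_filter -!dvdn_divisors // dvdn_gcd.
Qed.

Lemma ramanujan_sum_expi (R : realType) (n : nat) (k : int) :
  ramanujan_sum R n k =
  \sum_(1 <= j < n.+1 | coprime j n) expi (2 * @pi R * k%:~R / n%:R *+ j).
Proof.
apply: eq_bigr => j _; set x := (X in expi X).
have -> : 2%:R * (@pi R)%:C * 'i%C * j%:R * k%:~R / n%:R = x%:C * 'i%C.
  have -> : x%:C = 2%:R * (@pi R)%:C * k%:~R / n%:R * j%:R.
    rewrite /x -mulr_natr !rmorphM /= fmorphV !rmorph_nat rmorph_int.
    by [].
  by ring.
by rewrite /cexp; simpc; rewrite /= expR0; simpc.
Qed.

Lemma ramanujan_sum_divisors (R : realType) (n : nat) (k : int) : (0 < n)%N ->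
  ramanujan_sum R n k =
  \sum_(d <- divisors n) d%:R * (mobius (n %/ d))%:~R * ((d%:Z %| k)%Z)%:R.
Proof.
move=> n0; rewrite ramanujan_sum_expi; pose E j := expi (2 * @pi R * k%:~R / n%:R *+ j).
transitivity (\sum_(1 <= j < n.+1)
    \sum_(d <- divisors n | (d %| j)%N) (mobius d)%:~R * E j).
  rewrite big_mkcond; apply: eq_bigr => j _.
  by rewrite -mulr_suml -coprime_mobius //; case: coprime; rewrite ?mul1r ?mul0r.
(* Replacing [d] by [n %/ d] makes the inner sum run over the multiples of [n %/ d] up to [n], which
   is a full sum of length [d] as in [sum_expi]. *)
rewrite (exchange_big_dep xpredT) //= -(perm_big _ (perm_divisors_complement n0)).
rewrite big_map; apply: eq_big_seq => d; rewrite -dvdn_divisors // => dn.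
have d0 := dvdn_gt0 n0 dn.
have nd0 : (0 < n %/ d)%N by rewrite divn_gt0 // dvdn_leq.
rewrite -mulr_sumr -{2}(divnK dn) sum_multiples // mulrAC mulrC -sum_expi //.
congr (_ * _); apply: eq_bigr => i _; rewrite /E mulrnA -[X in expi X]mulr_natr -[X in _ = expi X]mulr_natr.
congr (expi (_ * _)); rewrite -[LHS]mulr_natr -{1}(divnK dn) natrM.
by field; rewrite !pnatr_eq0 -!lt0n d0.
Qed.

Lemma ramanujan_corr_divisors (R : realType) (m1 m2 : nat) (a1 a2 : int) :
  (0 < m1)%N -> (0 < m2)%N ->
  ramanujan_corr R a1 a2 m1 m2 =
    (totient (lcmn m1 m2))%:R *
    (\sum_(d1 <- divisors m1 | coprimez d1%:Z a1)
      \sum_(d2 <- divisors m2 |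
              coprimez d2%:Z a2 && ((gcdn d1 d2)%:Z %| a1 - a2)%Z)
         (d1%:R * (mobius (m1 %/ d1)%N)%:~R *
            (d2%:R * (mobius (m2 %/ d2)%N)%:~R))
         / (totient (lcmn d1 d2))%:R).
Proof.
move=> m10 m20; rewrite /ramanujan_corr; set m := lcmn m1 m2.
have m0 : (0 < m)%N by rewrite lcmn_gt0 m10.
under eq_bigr => k _ do
  rewrite (ramanujan_sum_divisors R _ m10) (ramanujan_sum_divisors R _ m20) big_distrlr /=.
rewrite exchange_big /= [in RHS]big_mkcond big_distrr; apply: eq_big_seq => d1.
rewrite -dvdn_divisors // => d1m; rewrite exchange_big /=.
(* The condition on [d1] joins the inner filter, so that both sides can be compared pair by pair. *)
have -> : (if coprimez d1%:Z a1 then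
    \sum_(d2 <- divisors m2 | coprimez d2%:Z a2 && ((gcdn d1 d2)%:Z %| a1 - a2)%Z)
       d1%:R * (mobius (m1 %/ d1))%:~R * (d2%:R * (mobius (m2 %/ d2))%:~R) /
       (totient (lcmn d1 d2))%:R else 0) =
  \sum_(d2 <- divisors m2 |
      [&& coprimez d1%:Z a1, coprimez d2%:Z a2 & ((gcdn d1 d2)%:Z %| a1 - a2)%Z])
     d1%:R * (mobius (m1 %/ d1))%:~R * (d2%:R * (mobius (m2 %/ d2))%:~R) /
     (totient (lcmn d1 d2))%:R :> R[i].
  by case: coprimez => //=; rewrite big_pred0.
rewrite [in RHS]big_mkcond big_distrr; apply: eq_big_seq => d2.
rewrite -dvdn_divisors // => d2m /=.
have := @sum_coprime_two_classes R[i] m d1 d2 a1 a2 m0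
  (dvdn_trans d1m (dvdn_lcml _ _)) (dvdn_trans d2m (dvdn_lcmr _ _)).
under eq_bigr => k _ do rewrite mulrACA -natrM mulnb.
rewrite -mulr_sumr => ->; case: ifP => _; last by rewrite !mulr0.
by rewrite [RHS]mulrCA.
Qed.

(** * Multiplicative functions in the coprime double sum *)

Definition totient_ratio (F : numFieldType) (n : nat) : F := n%:R / (totient n)%:R.

Lemma totient_ratioM (F : numFieldType) (a b : nat) : coprime a b ->
  totient_ratio F (a * b) = totient_ratio F a * totient_ratio F b.
Proof.
by move=> cab; rewrite /totient_ratio totient_coprime // !natrM invfM mulrACA.
Qed.

Lemma totient_ratioX (F : numFieldType) (p k : nat) : prime p -> (0 < k)%N ->
  totient_ratio F (p ^ k.+1) = totient_ratio F (p ^ k).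
Proof.
move=> pp; case: k => // k _; rewrite /totient_ratio !totient_pfactor //=.
have pF : p%:R != 0 :> F by rewrite pnatr_eq0 -lt0n prime_gt0.
have p1F : p.-1%:R != 0 :> F by rewrite pnatr_eq0; have := prime_gt1 pp; lia.
have pkF : (p ^ k)%:R != 0 :> F by rewrite natrX expf_neq0.
by rewrite !expnS !natrM; field; rewrite pF p1F pkF.
Qed.

Lemma totient_ratio_prime (F : numFieldType) (p : nat) : prime p ->
  totient_ratio F p = p%:R / (p%:R - 1).
Proof.
move=> pp; rewrite /totient_ratio totient_prime // -subn1 natrB //.
exact: prime_gt0.
Qed.

Lemma prime_subr1_neq0 (F : numFieldType) (p : nat) : prime p -> p%:R - 1 != 0 :> F.
Proof. by move=> pp; rewrite subr_eq0 pnatr_eq1; have := prime_gt1 pp; lia. Qed.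

(** This carries the dependence on [d] of the inner sum over the divisors of a squarefree [m]. Its
    local factor is [-1] if [p] divides [d] and [1 / (p - 1)] otherwise; the ratio of the two is
    [1 - p]. *)
Definition prime_weight (F : numFieldType) (m d : nat) : F :=
  \prod_(p <- primes m) (if (p %| d)%N then 1 - p%:R else 1).

Lemma prime_weightM (F : numFieldType) (m a b : nat) : coprime a b ->
  prime_weight F m (a * b) = prime_weight F m a * prime_weight F m b.
Proof.
move=> cab; rewrite -big_split; apply: eq_big_seq => p.
rewrite mem_primes => /and3P[pp _ _] /=; rewrite Euclid_dvdM //.
case: (boolP (p %| a)%N) => pa; last by rewrite mul1r.
case: (boolP (p %| b)%N) => pb /=; last by rewrite mulr1.
have : (p %| 1)%N by rewrite -(eqP cab) dvdn_gcd pa.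
by rewrite dvdn1 => /eqP p1; move: pp; rewrite p1.
Qed.

Lemma prime_weight1 (F : numFieldType) (m : nat) : prime_weight F m 1 = 1.
Proof.
rewrite /prime_weight big_seq big1 // => p; rewrite mem_primes => /and3P[pp _ _].
by rewrite dvdn1; case: eqP => // p1; move: pp; rewrite p1.
Qed.

Lemma prime_weightX (F : numFieldType) (m p k : nat) : (0 < k)%N ->
  prime_weight F m (p ^ k.+1) = prime_weight F m (p ^ k).
Proof.
move=> k0; apply: eq_big_seq => q; rewrite mem_primes => /and3P[qp _ _].
by rewrite !Euclid_dvdX // k0.
Qed.

Lemma prime_weight_prime (F : numFieldType) (m p : nat) : (0 < m)%N -> prime p ->
  prime_weight F m p = if (p %| m)%N then 1 - p%:R else 1.
Proof.
move=> m0 pp; have pmE : (p \in primes m) = (p %| m)%N by rewrite mem_primes pp m0.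
have off (q : nat) : q \in primes m -> q != p -> (q %| p)%N = false.
  rewrite mem_primes => /and3P[qp _ _] qNp; rewrite dvdn_prime2 //.
  exact: negbTE.
rewrite /prime_weight -pmE; case: (boolP (p \in primes m)) => [pm|pNm].
  rewrite (bigD1_seq p) ?primes_uniq //= dvdnn big_seq_cond big1 ?mulr1 // => q.
  by move=> /andP[qm qNp]; rewrite off.
rewrite big_seq big1 // => q qm; rewrite off //.
by apply: contraNneq pNm => <-.
Qed.

(** * Squarefree numbers and products over their primes *)

Lemma squarefree_logn (n p : nat) : squarefree n -> (logn p n <= 1)%N.
Proof.
case/andP=> n0 /allP sq; have [pn|] := boolP (p \in primes n); last first.
  by rewrite -logn_gt0 lt0n negbK => /eqP ->.
have := sq p pn; move: pn; rewrite mem_primes => /andP[pp _].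
by rewrite pfactor_dvdn // -ltnNge.
Qed.

Lemma squarefree_of_logn (n : nat) : (0 < n)%N -> (forall p, (logn p n <= 1)%N) ->
  squarefree n.
Proof.
move=> n0 H; rewrite /squarefree n0; apply/allP => p.
by rewrite mem_primes => /and3P[pp _ _]; rewrite pfactor_dvdn // -ltnNge ltnS.
Qed.

Lemma squarefree_lcm (m n : nat) : squarefree m -> squarefree n ->
  squarefree (lcmn m n).
Proof.
move=> sm sn; have [m0 _] := andP sm; have [n0 _] := andP sn.
apply: squarefree_of_logn => [|p]; first by rewrite lcmn_gt0 m0.
by rewrite logn_lcm // geq_max !squarefree_logn.
Qed.

Lemma squarefree_gcd (m n : nat) : squarefree m -> squarefree n ->
  squarefree (gcdn m n).
Proof.
move=> sm sn; have [m0 _] := andP sm; have [n0 _] := andP sn.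
apply: squarefree_of_logn => [|p]; first by rewrite gcdn_gt0 m0.
by rewrite logn_gcd // geq_min squarefree_logn.
Qed.

Lemma squarefree_logn1 (n p : nat) : squarefree n -> p \in primes n -> logn p n = 1%N.
Proof. by move=> sn; rewrite -logn_gt0; have := squarefree_logn p sn; lia. Qed.

Lemma squarefree_prod_primes (n : nat) : squarefree n ->
  n = (\prod_(p <- primes n) p)%N.
Proof.
move=> sn; have [n0 _] := andP sn.
rewrite {1}(prod_prime_decomp n0) prime_decompE big_map /=; apply: eq_big_seq => p pn.
by rewrite squarefree_logn1 ?expn1.
Qed.

Lemma totient_squarefree (F : numFieldType) (n : nat) : squarefree n ->
  (totient n)%:R = \prod_(p <- primes n) (p%:R - 1) :> F.
Proof.
move=> sn; have [n0 _] := andP sn.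
rewrite totientE // natr_prod; apply: eq_big_seq => p pn.
rewrite squarefree_logn1 // muln1 -subn1 natrB // prime_gt0 //.
by move: pn; rewrite mem_primes => /andP[].
Qed.

Lemma dedekind_psi_squarefree (F : numFieldType) (n : nat) : squarefree n ->
  dedekind_psi F n = \prod_(p <- primes n) (p%:R + 1).
Proof.
move=> sn; rewrite /dedekind_psi {1}(squarefree_prod_primes sn) natr_prod -big_split.
apply: eq_big_seq => p; rewrite mem_primes => /and3P[pp _ _] /=.
by rewrite mulrDr mulr1 mulfV // pnatr_eq0 -lt0n prime_gt0.
Qed.

Lemma perm_primes_lcm (m n : nat) : (0 < m)%N -> (0 < n)%N ->
  perm_eq (primes (lcmn m n)) (primes m ++ [seq p <- primes n | ~~ (p %| m)%N]).
Proof.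
move=> m0 n0; apply: uniq_perm; rewrite ?primes_uniq //.
  rewrite cat_uniq primes_uniq filter_uniq ?primes_uniq // andbT /=.
  apply/hasPn => p; rewrite mem_filter => /andP[pNm _] /=.
  by rewrite mem_primes (negbTE pNm) !andbF.
move=> p; rewrite mem_cat mem_filter -!logn_gt0 logn_lcm // leq_max.
case: (boolP (p %| m)%N) => pm /=; last by [].
rewrite orbF; apply/idP/idP => [/orP[//|]|->//].
by rewrite !logn_gt0 !mem_primes pm m0 => /andP[->].
Qed.

Lemma perm_primes_gcd (m n : nat) : (0 < m)%N -> (0 < n)%N ->
  perm_eq (primes (gcdn m n)) [seq p <- primes n | (p %| m)%N].
Proof.
move=> m0 n0; apply: uniq_perm; rewrite ?filter_uniq ?primes_uniq // => p.
rewrite mem_filter !mem_primes n0 gcdn_gt0 m0 dvdn_gcd /=.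
by case: (p %| m)%N; rewrite ?andbT ?andbF.
Qed.

(** * Evaluation of the coprime double sum *)

Lemma coprime_mobius_double_sum (F : numFieldType) (m1 m2 : nat) :
  (0 < m1)%N -> (0 < m2)%N ->
  \sum_(d1 <- divisors m1) \sum_(d2 <- divisors m2 | coprime d1 d2)
     (d1%:R * (mobius (m1 %/ d1)%N)%:~R * (d2%:R * (mobius (m2 %/ d2)%N)%:~R))
       / (totient (lcmn d1 d2))%:R =
  (if squarefree m1 && squarefree m2 then
     (\prod_(p <- primes m1) (p%:R - 1)^-1) *
     \prod_(p <- primes m2) (if (p %| m1)%N then - (p%:R + 1) else (p%:R - 1)^-1)
   else 0) :> F.
Proof.
move=> m10 m20; rewrite (exchange_big_dep xpredT) //=.
pose f d2 d1 : F := totient_ratio F d1 * (coprime d1 d2)%:R.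
(* For coprime [d1] and [d2] the totient of the lcm is a product, so the summand separates; the
   coprimality condition becomes the 0/1 factor in [f d2], which is multiplicative in [d1]. *)
transitivity (\sum_(d2 <- divisors m2) totient_ratio F d2 * (mobius (m2 %/ d2))%:~R *
    \sum_(d1 <- divisors m1) f d2 d1 * (mobius (m1 %/ d1))%:~R).
  apply: eq_big_seq => d2; rewrite -dvdn_divisors // => d2m.
  rewrite mulr_sumr big_mkcond; apply: eq_bigr => d1 _; rewrite /f.
  case: (boolP (coprime d1 d2)) => [cd|_]; last by rewrite mulr0 mul0r mulr0.
  have -> : lcmn d1 d2 = (d1 * d2)%N by rewrite -muln_lcm_gcd (eqP cd) muln1.
  rewrite mulr1 totient_coprime // natrM invfM /totient_ratio; set u := _%:~R; set v := _%:~R.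
  by ring.
have f_sum d2 : \sum_(d1 <- divisors m1) f d2 d1 * (mobius (m1 %/ d1))%:~R =
    if squarefree m1 then
      (\prod_(p <- primes m1) (p%:R - 1)^-1) * prime_weight F m1 d2 else 0.
  rewrite (mobius_sum (f := f d2)) //; first last.
  - by move=> p k pp k0; rewrite /f totient_ratioX // !coprime_pexpl.
  - by move=> a b _ _ cab; rewrite /f totient_ratioM // coprimeMl -mulnb natrM mulrACA.
  - by rewrite /f coprime1n /totient_ratio divr1 mulr1.
  case: ifP => // _; rewrite -big_split; apply: eq_big_seq => p.
  rewrite mem_primes => /and3P[pp _ _] /=; rewrite /f totient_ratio_prime //.
  have pF := prime_subr1_neq0 F pp.
  rewrite prime_coprime //; case: (p %| d2)%N => /=; by field.
case: (squarefree m1) f_sum => f_sum /=; last first.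
  by apply: big1 => d2 _; rewrite [X in _ * X]f_sum mulr0.
transitivity ((\prod_(p <- primes m1) (p%:R - 1)^-1) *
  \sum_(d2 <- divisors m2)
     (totient_ratio F d2 * prime_weight F m1 d2) * (mobius (m2 %/ d2))%:~R).
  rewrite mulr_sumr; apply: eq_bigr => d2 _.
  by rewrite [X in _ * X = _]f_sum mulrCA; congr (_ * _); rewrite mulrAC.
rewrite (mobius_sum (f := fun d => totient_ratio F d * prime_weight F m1 d)) //; first last.
- by move=> p k pp k0; rewrite totient_ratioX // prime_weightX.
- by move=> a b _ _ cab; rewrite totient_ratioM // prime_weightM // mulrACA.
- by rewrite prime_weight1 /totient_ratio divr1 mulr1.
case: ifP => _; last by rewrite mulr0.
(* The local factor is [p / (p - 1) * (1 - p) - 1 = - (p + 1)] if [p] divides [m1], and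
   [p / (p - 1) - 1 = 1 / (p - 1)] otherwise. *)
congr (_ * _); apply: eq_big_seq => p; rewrite mem_primes => /and3P[pp _ _].
rewrite totient_ratio_prime // prime_weight_prime //.
by have pF := prime_subr1_neq0 F pp; case: (p %| m1)%N; field.
Qed.

(** The totient is the product of [p - 1] over the primes of [m1] and those of [m2] not dividing
    [m1]. It cancels all the inverses and leaves [- (p + 1)] for each common prime, hence the sign
    and the Dedekind function of the gcd. *)
Lemma totient_lcm_prod (F : numFieldType) (m1 m2 : nat) :
  squarefree m1 -> squarefree m2 ->
  (totient (lcmn m1 m2))%:R * ((\prod_(p <- primes m1) (p%:R - 1)^-1) *
     \prod_(p <- primes m2) (if (p %| m1)%N then - (p%:R + 1) else (p%:R - 1)^-1)) =
  (-1) ^+ omega (gcdn m1 m2) * dedekind_psi F (gcdn m1 m2).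
Proof.
move=> s1 s2; have [m10 _] := andP s1; have [m20 _] := andP s2.
have prim n p : p \in primes n -> p%:R - 1 != 0 :> F.
  by rewrite mem_primes => /and3P[pp _ _]; apply: prime_subr1_neq0.
rewrite totient_squarefree ?squarefree_lcm // dedekind_psi_squarefree ?squarefree_gcd //.
rewrite (perm_big _ (perm_primes_lcm m10 m20)) (perm_big _ (perm_primes_gcd m10 m20)).
rewrite /omega (perm_size (perm_primes_gcd m10 m20)) big_cat /= !big_filter.
rewrite [X in _ * (_ * X)](bigID (fun p => (p %| m1)%N)) /= mulrACA -big_split /=.
rewrite big_seq big1 ?mul1r => [|p pm]; last by rewrite mulfV // (prim m1).
rewrite mulrCA -[X in _ * X]big_split /= [X in _ * X]big_seq_cond.
rewrite [X in _ * X]big1 ?mulr1; last first.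
  by move=> p /andP[pm /negbTE ->]; rewrite mulfV // (prim m2).
rewrite (eq_bigr (fun p => -1 * (p%:R + 1))); last by move=> p ->; rewrite mulN1r.
rewrite big_split /=; congr (_ * _).
by rewrite big_const_seq iter_mulr_1 size_filter.
Qed.

Theorem corollary10 (R : realType) (m1 m2 : nat) (a1 a2 : int)
    (m1_gt0 : (0 < m1)%N) (m2_gt0 : (0 < m2)%N) :
  ramanujan_corr R a1 a2 m1 m2 =
    (totient (lcmn m1 m2))%:R *
    (\sum_(d1 <- divisors m1 | coprimez d1%:Z a1)
      \sum_(d2 <- divisors m2 |
              coprimez d2%:Z a2 && ((gcdn d1 d2)%:Z %| a1 - a2)%Z)
         (d1%:R * (mobius (m1 %/ d1)%N)%:~R *
            (d2%:R * (mobius (m2 %/ d2)%N)%:~R))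
         / (totient (lcmn d1 d2))%:R)
  /\ (coprimez a1 m1%:Z -> coprimez a2 m2%:Z -> `|a1 - a2| = 1 ->
      ramanujan_corr R a1 a2 m1 m2 =
        if squarefree m1 && squarefree m2 then
          (-1) ^+ omega (gcdn m1 m2) * dedekind_psi R[i] (gcdn m1 m2)
        else 0).
Proof.
have formula := @ramanujan_corr_divisors R m1 m2 a1 a2 m1_gt0 m2_gt0.
split=> // c1 c2 a12; rewrite {}formula.
have cop (m d : nat) (a : int) : coprimez a m%:Z -> (d %| m)%N -> coprimez d%:Z a.
  by move=> cam dm; rewrite coprimez_sym; apply: coprimez_dvdr dm _.
have gcdE d1 d2 : ((gcdn d1 d2)%:Z %| a1 - a2)%Z = coprime d1 d2.
  have a12N : `|a1 - a2|%N = 1%N by apply/eqP; rewrite -eqz_nat abszE a12.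
  by rewrite dvdzE a12N dvdn1.
(* Divisors inherit coprimality to [a1] and [a2], and a gcd dividing [a1 - a2], of absolute value 1,
   must be 1; so only [coprime d1 d2] remains of the filters. *)
have -> : \sum_(d1 <- divisors m1 | coprimez d1%:Z a1)
    \sum_(d2 <- divisors m2 | coprimez d2%:Z a2 && ((gcdn d1 d2)%:Z %| a1 - a2)%Z)
       (d1%:R * (mobius (m1 %/ d1)%N)%:~R * (d2%:R * (mobius (m2 %/ d2)%N)%:~R))
         / (totient (lcmn d1 d2))%:R =
  \sum_(d1 <- divisors m1) \sum_(d2 <- divisors m2 | coprime d1 d2)
     (d1%:R * (mobius (m1 %/ d1)%N)%:~R * (d2%:R * (mobius (m2 %/ d2)%N)%:~R))
       / (totient (lcmn d1 d2))%:R :> R[i].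
  rewrite big_mkcond; apply: eq_big_seq => d1; rewrite -dvdn_divisors // => d1m.
  rewrite (cop _ _ _ c1 d1m) big_mkcond [RHS]big_mkcond; apply: eq_big_seq => d2.
  by rewrite -dvdn_divisors // => d2m; rewrite (cop _ _ _ c2 d2m) gcdE.
rewrite coprime_mobius_double_sum //; case: ifP => [/andP[s1 s2]|_]; last by rewrite mulr0.
exact: totient_lcm_prod.
Qed.
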